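(* The family of permutahedra, oriented by the weak Bruhat order, has asymptotic $k$-length $1$ for all $k\ge1$, and therefore asymptotic total length $1$.
   Context: An oriented polytope is a convex polytope $P\subset\mathbb{R}^d$ together with a linear functional $\psi$ that is not constant along any edge of $P$. The functional orients each edge, and the vertex set of $P$ becomes a poset by taking the reflexive-transitive closure of this orientation. Every nonempty face has a unique bottom vertex and a unique top vertex. For nonempty faces $F,G$ write $F\le G$ if the top vertex of $F$ is less than or equal to the bottom vertex of $G$ in the vertex poset of $P$. A face chain of length $k$ in $P$ is a sequence $\mathbf{F}=(F_1\le F_2\le\cdots\le F_k)$ of nonempty faces of $P$. Its excess is $\mathrm{exc}(\mathbf{F})=(\dim P-1)-\sum_{i=1}^k(\dim F_i-1)$. Let $e_k(P)$ be the minimum excess of a length $k$ face chain in $P$ (for $k=1$ the trivial chain consisting of $P$ itself is excluded). Let $E_k(n)=(n-1)-k(n-2)=(1-k)n+2k-1$. A family of polytopes $P^\bullet$ consists of one oriented polytope $P^n$ of dimension $n$ for each $n\ge1$. The family has asymptotic $k$-length $\alpha_k$ if $\lim_{n\to\infty} e_k(P^n)/E_k(n)=\alpha_k$. It has asymptotic total length $\alpha$ if the $\alpha_k$ are well-defined for every $k$ and $\lim_{k\to\infty}\alpha_k=\alpha$. The permutahedron $\mathbb{P}^N\subset\mathbb{R}^N$ is the convex hull of the points $(\sigma(1),\ldots,\sigma(N))$, $\sigma\in S_N$. It has dimension $N-1$, so the $n$-dimensional member of the family of permutahedra is $\mathbb{P}^{n+1}$. Its nonempty faces are labelled by ordered set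 partitions of $\{1,\ldots,N\}$ (sequences of disjoint nonempty parts with union $\{1,\ldots,N\}$), face inclusion corresponding to refinement of ordered partitions. The face labelled by an ordered partition with $p$ parts has dimension $N-p$. A vertex corresponds to an ordered partition into singletons, i.e. a permutation, and its coordinates are given by the inverse permutation. The orientation comes from the functional $\psi(\mathbf{v})=\sum_{i=1}^N i\,\mathbf{v}_i$, with edges directed so that the vertex labelled $[1][2]\cdots[N]$ is the minimum (i.e. in the direction of decreasing $\psi$). The resulting vertex poset is the weak Bruhat order. For an ordered partition $\tau$ let $\tau(i)$ be the index of the part of $\tau$ containing $i$. In these terms, the relation $\tau\le\rho$ on faces holds if and only if for every pair $i<j$ one has $\tau(i)<\tau(j)$ or $\rho(i)>\rho(j)$ (strict inequalities). *)

(* Defs.v *)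
From HB Require Import structures.
From mathcomp Require Import all_boot all_order all_algebra all_fingroup.
From mathcomp Require Import all_classical all_reals all_analysis.
From Stdlib Require Import Relation_Operators.

Set Implicit Arguments.
Unset Strict Implicit.
Unset Printing Implicit Defensive.

Import Order.TTheory GRing.Theory Num.Theory.
Import numFieldNormedType.Exports.

Local Open Scope classical_set_scope.
Local Open Scope ring_scope.

Section ConvexGeometry.
Variables (R : realType) (d : nat).
Implicit Types (A F : set 'rV[R]_d) (v : 'rV[R]_d).

Definition conv_hull A : set 'rV[R]_d :=
  [set x | exists (m : nat) (a : 'I_m -> R) (p : 'I_m -> 'rV[R]_d),
     [/\ forall i, 0 <= a i, \sum_i a i = 1, forall i, A (p i)
       & x = \sum_i a i *: p i]].

Definition is_polytope A : Prop :=
  exists2 S : set 'rV[R]_d, finite_set S & A = conv_hull S.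

Definition affinely_independent (m : nat) (p : 'I_m.+1 -> 'rV[R]_d) : bool :=
  row_free (\matrix_(i < m) (p (lift ord0 i) - p ord0)).

(* The dimension of the affine hull of A, as the largest m such that A contains
   m + 1 affinely independent points; the value on the empty set is 0. *)
Definition affdim A : nat :=
  \max_(m < d.+1 | `[< exists2 p : 'I_m.+1 -> 'rV[R]_d,
                       forall i, A (p i) & affinely_independent p >]) m.

(* Nonempty faces only; c = 0 gives the improper face A. *)
Definition is_face A F : Prop :=
  F !=set0 /\
  exists c : {scalar 'rV[R]_d},
    F = [set x | A x /\ forall y, A y -> c y <= c x].

Definition is_vertex A v : Prop := is_face A [set v].

Definition is_edge A F : Prop := is_face A F /\ affdim F = 1%N.

End ConvexGeometry.

(* Raw data; the conditions making it an oriented polytope are in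
   is_oriented_polytope. *)
Record polytope_data (R : realType) := PolytopeData {
  ambient : nat;
  body : set 'rV[R]_ambient;
  functional : {scalar 'rV[R]_ambient}
}.
Arguments body {R} p.
Arguments functional {R} p.

Section OrientedPolytopes.
Variables (R : realType) (P : polytope_data R).
Local Notation point := 'rV[R]_(ambient P).
Implicit Types (v w : point) (F G : set point).

Definition is_oriented_polytope : Prop :=
  is_polytope (body P) /\
  forall F, is_edge (body P) F ->
    exists x y, [/\ F x, F y & functional P x != functional P y].

Definition dim : nat := affdim (body P).

(* Edges are directed towards increasing values of the functional. *)
Definition edge_step v w : Prop :=
  [/\ is_vertex (body P) v, is_vertex (body P) w,
      exists F, [/\ is_edge (body P) F, F v & F w]
    & functional P v < functional P w].

Definition vertex_le : point -> point -> Prop :=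
  clos_refl_trans point edge_step.

Definition is_bottom F v : Prop :=
  [/\ is_vertex (body P) v, F v
    & forall w, is_vertex (body P) w -> F w -> vertex_le v w].

Definition is_top F v : Prop :=
  [/\ is_vertex (body P) v, F v
    & forall w, is_vertex (body P) w -> F w -> vertex_le w v].

Definition face_le F G : Prop :=
  exists v w, [/\ is_top F v, is_bottom G w & vertex_le v w].

(* The last condition excludes the chain consisting of P itself. *)
Definition is_face_chain (k : nat) (F : 'I_k -> set point) : Prop :=
  [/\ forall i, is_face (body P) (F i),
      forall i j : 'I_k, j = i.+1 :> nat -> face_le (F i) (F j)
    & k = 1%N -> forall i, F i <> body P].

Definition exc (k : nat) (F : 'I_k -> set point) : int :=
  (dim%:Z - 1) - \sum_(i < k) ((affdim (F i))%:Z - 1).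

Definition is_min_excess (k : nat) (e : int) : Prop :=
  (exists2 F : 'I_k -> set point, is_face_chain F & exc F = e) /\
  (forall F : 'I_k -> set point, is_face_chain F -> e <= exc F).

End OrientedPolytopes.

Definition E (k n : nat) : int := (n%:Z - 1) - k%:Z * (n%:Z - 2).

Section Families.
Variables (R : realType) (P : nat -> polytope_data R).

(* The member of index 0 plays no role. *)
Definition is_polytope_family : Prop :=
  forall n, (1 <= n)%N -> is_oriented_polytope (P n) /\ dim (P n) = n.

Definition has_asymptotic_k_length (k : nat) (alpha : R) : Prop :=
  exists2 e : nat -> int,
    forall n, (1 <= n)%N -> is_min_excess (P n) k (e n)
    & (fun n => (e n)%:~R / (E k n)%:~R : R) @ \oo --> alpha.

Definition has_asymptotic_total_length (alpha : R) : Prop :=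
  exists2 a : nat -> R,
    forall k, (1 <= k)%N -> has_asymptotic_k_length k (a k)
    & a @ \oo --> alpha.

End Families.

Section Permutahedra.
Variable R : realType.

(* 'I_N is numbered from 0, hence the shifts by one. *)
Definition perm_point (N : nat) (s : 'S_N) : 'rV[R]_N := \row_i (s i).+1%:R.

(* The opposite of psi(v) = \sum_i i v_i: the permutahedron is oriented in the
   direction of decreasing psi, so that the identity is the minimum. *)
Definition weak_functional (N : nat) (v : 'rV[R]_N) : R :=
  - \sum_(i < N) i.+1%:R * v ord0 i.

Fact weak_functional_is_linear (N : nat) : scalar (@weak_functional N).
Proof.
move=> a u v; rewrite /weak_functional mulrN -opprD mulr_sumr -big_split /=.
by congr (- _); apply: eq_bigr => i _; rewrite !mxE mulrDr mulrCA.
Qed.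

HB.instance Definition _ (N : nat) :=
  GRing.isLinear.Build R 'rV[R]_N R *%R (@weak_functional N)
    (@weak_functional_is_linear N).

Definition permutahedron (N : nat) : polytope_data R :=
  @PolytopeData R N (conv_hull (range (@perm_point N))) (@weak_functional N).

Definition permutahedra (n : nat) : polytope_data R := permutahedron n.+1.

End Permutahedra.

(* Main.v *)
From HB Require Import structures.
Require Import Defs.
From mathcomp Require Import all_boot all_order all_algebra all_fingroup.
From mathcomp Require Import all_classical all_reals all_analysis.
From mathcomp Require Import zify ring lra.
From Stdlib Require Import Relation_Operators.

Set Implicit Arguments.
Unset Strict Implicit.
Unset Printing Implicit Defensive.

Import Order.TTheory GRing.Theory Num.Theory.
Import numFieldNormedType.Exports.

Local Open Scope ring_scope.

(* For k > 1 every face has dimension at most n, which gives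
   e_k(P^n) >= (1 - k)(n - 1), and E_k(n) is asymptotic to (1 - k) n. It remains
   to find a chain of k faces whose ordered partitions have o(n) parts. Fix a
   base r and let the m-th partition order the integers i by increasing
   i / r^(m+1), then by decreasing i mod r^m, forgetting the m-th digit: it has
   at most n / r + r^k parts. If i < j agree above digit m, then they are
   inverted by the (m+1)-st partition, and otherwise the m-th one separates
   them in the right order, so consecutive faces are comparable. Hence
   |e_k - E_k| <= k (n / r + r^k) for every r. For k = 1 facets give e_1 = 1.

   Geometrically, a face is the set of maxima of x |-> sum_i c_i x_i, and its
   vertices are the permutations s with s_i < s_j whenever c_i < c_j; its top
   and bottom sort by c, ties being broken by decreasing or increasing index. *)

(** * Affine dimension, and faces of convex hulls *)

Lemma affdim_ge (R : realType) (d r : nat) (A : set 'rV[R]_d) (x0 : 'rV[R]_d)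
    (M : 'M[R]_(r, d)) :
  A x0 -> (forall l, A (x0 + row l M)) -> (\rank M <= affdim A)%N.
Proof.
move=> Ax0 AM; rewrite /affdim.
have lt_rd : (\rank M < d.+1)%N by rewrite ltnS rank_leq_col.
rewrite -[\rank M]/(nat_of_ord (Ordinal lt_rd)); apply: leq_bigmax_cond => /=.
apply/asboolP.
(* The base point [x0] sits at index 0; the others are its translates by a maximal independent
   family of rows of [M]. *)
exists (fun o : 'I_(\rank M).+1 =>
  oapp (fun l => x0 + row (maxrankfun M l) M) x0 (unlift ord0 o)).
  by move=> i; case: (unlift _ _) => //= l.
rewrite /affinely_independent; set B := (X in row_free X).
suff -> : B = rowsub (maxrankfun M) M by apply: maxrowsub_free.
apply/matrixP => i j; rewrite !mxE.
by rewrite liftK unlift_none /= !mxE addrAC subrr add0r.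
Qed.

Lemma affdim_le (R : realType) (d r : nat) (A : set 'rV[R]_d)
    (B : 'M[R]_(r, d)) :
  (forall x y, A x -> A y -> (x - y <= B)%MS) -> (affdim A <= \rank B)%N.
Proof.
move=> AB; apply/bigmax_leqP => -[m /= _] /asboolP[p Ap].
rewrite /affinely_independent => /eqP rkp; rewrite -[leqLHS]rkp.
apply: mxrankS; apply/row_subP => i.
by rewrite rowK; apply: AB.
Qed.

Lemma affdimS (R : realType) (d : nat) (A B : set 'rV[R]_d) :
  (A `<=` B)%classic -> (affdim A <= affdim B)%N.
Proof.
move=> sAB; apply/bigmax_leqP => m /asboolP[p Ap fp].
by apply: leq_bigmax_cond; apply/asboolP; exists p => // i; apply: sAB.
Qed.

Lemma mem_conv_hull (R : realType) (d : nat) (S : set 'rV[R]_d) (x : 'rV[R]_d) :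
  S x -> conv_hull S x.
Proof.
move=> Sx; exists 1%N, (fun=> 1), (fun=> x); split => //.
  by rewrite big_ord1.
by rewrite big_ord1 scale1r.
Qed.

Lemma conv_hull_scalar_le (R : realType) (d : nat) (S : set 'rV[R]_d)
    (c : {scalar 'rV[R]_d}) (M : R) (x : 'rV[R]_d) :
  (forall y, S y -> c y <= M) -> conv_hull S x -> c x <= M.
Proof.
move=> leM [m [a [p [a_ge0 a1 Sp ->]]]].
rewrite linear_sum -[leRHS]mul1r -a1 mulr_suml; apply: ler_sum => i _.
by rewrite linearZ /= ler_wpM2l // leM.
Qed.

(* A point of the face cut out by [c] is a convex combination of generators;
   those of nonzero weight lie on the face themselves. *)
Lemma face_conv_hull (R : realType) (d : nat) (S : set 'rV[R]_d)
    (c : {scalar 'rV[R]_d}) (x : 'rV[R]_d) :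
  conv_hull S x -> (forall y, conv_hull S y -> c y <= c x) ->
  exists (m : nat) (a : 'I_m -> R) (p : 'I_m -> 'rV[R]_d),
    [/\ \sum_i a i = 1, forall i, S (p i), x = \sum_i a i *: p i
      & forall i, a i != 0 -> c (p i) = c x].
Proof.
move=> [m [a [p [a_ge0 a1 Sp xE]]]] cmax; exists m, a, p; split => // i ai0.
have gap_ge0 j : 0 <= a j * (c x - c (p j)).
  by rewrite mulr_ge0 // subr_ge0 cmax //; apply: mem_conv_hull.
have gap0 : \sum_j a j * (c x - c (p j)) = 0.
  under eq_bigr do rewrite mulrBr.
  rewrite sumrB -mulr_suml a1 mul1r {1}xE linear_sum.
  by under eq_bigr do rewrite linearZ; rewrite subrr.
have /eqP := gap0; rewrite psumr_eq0 // => /allP/(_ i (mem_index_enum _)).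
by rewrite mulf_eq0 (negPf ai0) /= subr_eq0 => /eqP.
Qed.

Lemma affdim_set1 (R : realType) (d : nat) (v : 'rV[R]_d) :
  affdim [set v]%classic = 0%N.
Proof.
apply/eqP; rewrite -leqn0; rewrite -[leqRHS](mxrank0 R 1 d).
by apply: affdim_le => x y /= -> ->; rewrite subrr sub0mx.
Qed.

(** * Faces of the permutahedron as colorings *)

Definition color_functional (R : realType) (N : nat) (c : 'I_N -> R)
  (x : 'rV[R]_N) : R := \sum_i c i * x ord0 i.

Fact color_functional_is_linear (R : realType) (N : nat) (c : 'I_N -> R) :
  scalar (color_functional c).
Proof.
move=> a u v; rewrite /color_functional mulr_sumr -big_split /=.
by apply: eq_bigr => i _; rewrite !mxE mulrDr mulrCA.
Qed.

HB.instance Definition _ (R : realType) (N : nat) (c : 'I_N -> R) :=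
  GRing.isLinear.Build R 'rV[R]_N R *%R (color_functional c)
    (color_functional_is_linear c).

Lemma scalar_color (R : realType) (N : nat) (c : {scalar 'rV[R]_N}) :
  c =1 color_functional (fun i => c (delta_mx ord0 i)).
Proof.
move=> x; rewrite {1}(row_sum_delta x) linear_sum; apply: eq_bigr => i _.
by rewrite linearZ mulrC.
Qed.

Definition perm_hull (R : realType) (N : nat) : set 'rV[R]_N :=
  conv_hull (range (@perm_point R N)).
Arguments perm_hull : clear implicits.

(* An ordered set partition is encoded by a coloring [c] whose level sets,
   in increasing order of color, are its parts. *)
Definition color_face (R : realType) (N : nat) (c : 'I_N -> R) : set 'rV[R]_N :=
  [set x | perm_hull R N x /\
     forall y, perm_hull R N y -> color_functional c y <= color_functional c x]%classic.

Definition compat (R : realType) (N : nat) (c : 'I_N -> R) (s : 'S_N) : bool :=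
  [forall i, forall j, (c i < c j) ==> (s i < s j)%N].

Lemma compatP (R : realType) (N : nat) (c : 'I_N -> R) (s : 'S_N) :
  reflect (forall i j, c i < c j -> (s i < s j)%N) (compat c s).
Proof.
apply: (iffP forallP) => [H i j|H i].
  by have /forallP/(_ j)/implyP := H i.
by apply/forallP => j; apply/implyP; apply: H.
Qed.

Lemma perm_val_count (N : nat) (s : 'S_N) (i : 'I_N) :
  (\sum_(j < N) (s j < s i) = s i)%N.
Proof.
rewrite -(reindex_inj (h := s) (P := xpredT)
  (F := fun v : 'I_N => (v < s i)%N : nat)) /=; last exact: perm_inj.
rewrite -big_mkcond /= -(big_ord_widen N (fun=> 1%N)) ?(ltnW (ltn_ord _)) //.
by rewrite sum1_card card_ord.
Qed.

Lemma perm_neq_lt (N : nat) (s : 'S_N) (i j : 'I_N) :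
  i != j -> (s i < s j)%N = ~~ (s j < s i)%N.
Proof.
move=> nij; rewrite -leqNgt ltn_neqAle andb_idl // => _.
by rewrite (inj_eq val_inj) (inj_eq perm_inj).
Qed.

(** The maximum of [color_functional c] over the permutahedron; the first sum comes from coordinates
    starting at 1, the second takes each unordered pair once. *)
Definition color_bound (R : realType) (N : nat) (c : 'I_N -> R) : R :=
  \sum_i c i + 2^-1 * \sum_i \sum_j (if i == j then 0 else Num.max (c i) (c j)).

(* Since [s i] counts the [j] with [s j < s i], twice the sum of the [c i * s i]
   is the sum, over ordered pairs, of the color of the element of larger value;
   it is maximal exactly when that element always has the larger color. *)
Lemma color_functional_leif (R : realType) (N : nat) (c : 'I_N -> R) (s : 'S_N) :
  color_functional c (perm_point R s) <= color_bound c ?= iff compat c s.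
Proof.
have -> : color_functional c (perm_point R s) = \sum_i c i + 2^-1 *
    \sum_i \sum_j (c i * (s j < s i)%N%:R + c j * (s i < s j)%N%:R).
  have E2 : \sum_i \sum_j (c i * (s j < s i)%N%:R + c j * (s i < s j)%N%:R) =
            2 * \sum_i c i * (s i)%:R.
    under eq_bigr do rewrite big_split /=.
    rewrite big_split /= [X in _ + X]exchange_big /= -mulr2n mulr_natl.
    congr (_ *+ _); apply: eq_bigr => i _; rewrite -mulr_sumr.
    by rewrite -natr_sum perm_val_count.
  rewrite E2 mulKf ?pnatr_eq0 // -big_split /=; apply: eq_bigr => i _.
  by rewrite mxE -natr1 mulrDr mulr1 addrC.
rewrite /color_bound (mono_leif (lerD2l _)).
rewrite (mono_leif (ler_pM2l _)) ?invr_gt0 ?ltr0n //.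
have leif_pair i j : c i * (s j < s i)%N%:R + c j * (s i < s j)%N%:R <=
    (if i == j then 0 else Num.max (c i) (c j))
    ?= iff [&& (c i < c j) ==> (s i < s j)%N & (c j < c i) ==> (s j < s i)%N].
  have [->|nij] := eqVneq i j.
    by rewrite ltnn !mulr0 addr0 ltxx; apply: leif_refl.
  rewrite (perm_neq_lt s nij); case: (s j < s i)%N;
    rewrite /= ?mulr1 ?mulr0 ?addr0 ?add0r.
    rewrite implybT implybF andbT -leNgt; apply/leifP.
    by case: (ltgtP (c j) (c i)) => // ->.
  rewrite implybT implybF -leNgt; apply/leifP.
  by case: (ltgtP (c i) (c j)) => //= ce; rewrite ce.
have [le_sum eq_sum] := leif_sum (P := xpredT)
  (fun i _ => leif_sum (P := xpredT) (fun j _ => leif_pair i j)).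
split=> //; rewrite eq_sum; apply/forallP/compatP => [H i j ltc|H i /=].
  by have /forallP/(_ j)/andP[/implyP/(_ ltc)] := H i.
by apply/forallP => j; apply/andP; split; apply/implyP; apply: H.
Qed.

(** * Permutations that sort by color *)

Lemma rank_perm (N : nat) (lt : rel 'I_N) :
  irreflexive lt -> transitive lt -> (forall i j, i != j -> lt i j || lt j i) ->
  exists s : 'S_N, forall i j, (s i < s j)%N = lt i j.
Proof.
move=> irr tr tot.
have rk_lt i : (#|[set j | lt j i]%SET| < N)%N.
  rewrite -[X in (_ < X)%N]card_ord; apply/proper_card/properP.
  by split; [apply/fintype.subsetP | exists i; rewrite ?inE ?irr].
(* The permutation sends [i] to the number of its predecessors for [lt]. *)
pose f i := Ordinal (rk_lt i).
have f_mono i j : lt i j -> (f i < f j)%N.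
  move=> ltij; apply/proper_card/properP; split.
    by apply/fintype.subsetP => l; rewrite !inE => /tr; apply.
  by exists i; rewrite !inE ?irr.
have f_inj : injective f.
  move=> i j fij; apply/eqP; apply: contraT => /tot /orP[] /f_mono;
  by rewrite fij ltnn.
exists (perm f_inj) => i j; rewrite !permE.
case E : (lt i j); first exact: f_mono.
have [->|/tot] := eqVneq i j; first by rewrite ltnn.
by rewrite E /= => /f_mono/ltnW; rewrite leqNgt => /negbTE.
Qed.

Lemma color_rank (R : realType) (N : nat) (c : 'I_N -> R) (tie : rel 'I_N) :
  irreflexive tie -> transitive tie -> (forall i j, i != j -> tie i j || tie j i) ->
  exists t : 'S_N, forall i j,
    (t i < t j)%N = (c i < c j) || ((c i == c j) && tie i j).
Proof.
move=> irr tr tot; apply: rank_perm => [i|j i k|i j nij].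
- by rewrite ltxx irr andbF.
- case: (ltgtP (c i) (c j)) => //= cij; case: (ltgtP (c j) (c k)) => //= cjk.
  + by rewrite (lt_trans cij cjk).
  + by rewrite -cjk cij.
  + by rewrite cij cjk.
  + by rewrite cij cjk ltxx eqxx /=; apply: tr.
- by case: (ltgtP (c i) (c j)) => //= _; apply: tot.
Qed.

Lemma color_top (R : realType) (N : nat) (c : 'I_N -> R) :
  exists t : 'S_N, forall i j,
    (t i < t j)%N = (c i < c j) || ((c i == c j) && (j < i)%N).
Proof.
apply: (color_rank _ (tie := fun i j => (j < i)%N)) => [i|j i k|i j] /=.
- exact: ltnn.
- by move=> ltji ltkj; apply: ltn_trans ltkj ltji.
- by rewrite orbC -neq_ltn.
Qed.

Lemma color_bottom (R : realType) (N : nat) (c : 'I_N -> R) :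
  exists t : 'S_N, forall i j,
    (t i < t j)%N = (c i < c j) || ((c i == c j) && (i < j)%N).
Proof.
apply: (color_rank _ (tie := fun i j => (i < j)%N)) => [i|j i k|i j] /=.
- exact: ltnn.
- exact: ltn_trans.
- by rewrite -neq_ltn.
Qed.

(** * Points and vertices of the faces *)

Lemma perm_hull_point (R : realType) (N : nat) (s : 'S_N) :
  perm_hull R N (perm_point R s).
Proof. by apply: mem_conv_hull; exists s. Qed.

Lemma perm_hull_le_bound (R : realType) (N : nat) (c : 'I_N -> R) (x : 'rV[R]_N) :
  perm_hull R N x -> color_functional c x <= color_bound c.
Proof.
apply: conv_hull_scalar_le => _ [s _ <-].
by rewrite color_functional_leif.
Qed.

(** The bound is attained, for instance at the permutation that sorts by color. *)
Lemma color_face_max (R : realType) (N : nat) (c : 'I_N -> R) (x : 'rV[R]_N) :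
  color_face c x -> color_functional c x = color_bound c.
Proof.
case=> hx xmax; apply/eqP; rewrite eq_le perm_hull_le_bound //=.
have [t tE] := color_top c.
have /eqP <- : color_functional c (perm_point R t) == color_bound c.
  by rewrite color_functional_leif; apply/compatP => i j ltc; rewrite tE ltc.
by apply/xmax/perm_hull_point.
Qed.

Lemma color_face_point (R : realType) (N : nat) (c : 'I_N -> R) (s : 'S_N) :
  color_face c (perm_point R s) <-> compat c s.
Proof.
rewrite -(color_functional_leif c s).2.
split=> [/color_face_max -> //|/eqP sE]; split; first exact: perm_hull_point.
by move=> y hy; rewrite sE perm_hull_le_bound.
Qed.

Lemma color_face_conv (R : realType) (N : nat) (c : 'I_N -> R) (x : 'rV[R]_N) :
  color_face c x -> exists (m : nat) (a : 'I_m -> R) (s : 'I_m -> 'S_N),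
    [/\ \sum_i a i = 1, x = \sum_i a i *: perm_point R (s i)
      & forall i, a i != 0 -> compat c (s i)].
Proof.
move=> Fx; have [hx xmax] := Fx.
have [m [a [p [a1 Sp xE pc]]]] := face_conv_hull hx xmax.
have {Sp} /choice[s sE] i : exists s, perm_point R s = p i.
  by case: (Sp i) => s _ <-; exists s.
exists m, a, s; split => // [|i ai0].
  by rewrite xE; apply: eq_bigr => i _; rewrite sE.
rewrite -(color_functional_leif c (s i)).2 sE; apply/eqP.
by rewrite -(color_face_max Fx); apply: pc.
Qed.

Lemma color_face_compat (R : realType) (N : nat) (c : 'I_N -> R) (x : 'rV[R]_N) :
  color_face c x -> exists2 s : 'S_N, compat c s & color_face c (perm_point R s).
Proof.
move=> /color_face_conv[m [a [s [a1 _ sc]]]].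
have [i ai0] : exists i, a i != 0.
  apply/existsP; apply: contraT; rewrite negb_exists => /forallP a0.
  move/eqP: a1; rewrite big1 => [|i _]; first by rewrite eq_sym oner_eq0.
  by apply/eqP; rewrite -[_ == _]negbK.
by exists (s i); [apply: sc | apply/color_face_point/sc].
Qed.

(** Points of the face are affine combinations of compatible permutation points, so a space of
    directions need only be tested at the latter. *)
Lemma color_face_dir (R : realType) (N r : nat) (c : 'I_N -> R)
    (x0 : 'rV[R]_N) (B : 'M[R]_(r, N)) :
  (forall s, compat c s -> (perm_point R s - x0 <= B)%MS) ->
  forall x, color_face c x -> (x - x0 <= B)%MS.
Proof.
move=> sB x /color_face_conv[m [a [s [a1 -> sc]]]].
rewrite -[x0]scale1r -a1 scaler_suml -sumrB; apply: summx_sub => i _.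
rewrite -scalerBr; have [->|ai0] := eqVneq (a i) 0; first by rewrite scale0r sub0mx.
by apply/scalemx_sub/sB/sc.
Qed.

(** A linear functional is the coloring by its values on the basis vectors. *)
Lemma face_is_color (R : realType) (N : nat) (F : set 'rV[R]_N) :
  is_face (perm_hull R N) F -> exists c : 'I_N -> R, F = color_face c.
Proof.
move=> [_ [c ->]]; exists (fun i => c (delta_mx ord0 i)).
by rewrite /color_face; apply: eq_set => x; rewrite scalar_color;
   apply/propext; split=> -[? xm]; split=> // y /xm; rewrite scalar_color.
Qed.

Lemma color_is_face (R : realType) (N : nat) (c : 'I_N -> R) :
  is_face (perm_hull R N) (color_face c).
Proof.
split; last by exists (color_functional c).
have [t tE] := color_top c; exists (perm_point R t).
by apply/color_face_point/compatP => i j ltc; rewrite tE ltc.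
Qed.

Lemma perm_point_inj (R : realType) (N : nat) : injective (@perm_point R N).
Proof.
move=> s t /rowP st; apply/permP => i; apply/val_inj.
by have /eqP := st i; rewrite !mxE eqr_nat eqSS => /eqP.
Qed.

Lemma color_face_set1 (R : realType) (N : nat) (c : 'I_N -> R) (s : 'S_N) :
  compat c s -> (forall t, compat c t -> t = s) ->
  color_face c = [set perm_point R s]%classic.
Proof.
move=> cs c1; apply/seteqP; split=> [x Fx|x ->] /=; last exact/color_face_point.
apply/eqP; rewrite -subr_eq0 -submx0.
by apply: color_face_dir Fx => t /c1 ->; rewrite subrr sub0mx.
Qed.

(** [s i] counts the indices below [i] in the order of [s], so this order determines [s]; one
    implication suffices because both orders are total. *)
Lemma same_order_eq (N : nat) (s t : 'S_N) :
  (forall i j, (s i < s j)%N -> (t i < t j)%N) -> t = s.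
Proof.
move=> st; apply/permP => i; apply/val_inj => /=.
rewrite -(perm_val_count t) -(perm_val_count s); apply: eq_bigr => j _.
congr nat_of_bool; have [->|nij] := eqVneq j i; first by rewrite !ltnn.
apply/idP/idP => [|/st//]; rewrite !(perm_neq_lt _ nij).
by apply: contra => /st.
Qed.

Lemma perm_point_vertex (R : realType) (N : nat) (s : 'S_N) :
  is_vertex (perm_hull R N) (perm_point R s).
Proof.
(* Coloring each index by its own value leaves [s] as the only compatible permutation. *)
rewrite /is_vertex -(@color_face_set1 _ _ (fun i => (s i)%:R)).
- exact: color_is_face.
- by apply/compatP => i j; rewrite ltr_nat.
- move=> t /compatP ct; apply: same_order_eq => i j lts; apply: ct.
  by rewrite ltr_nat.
Qed.

Lemma vertex_perm_point (R : realType) (N : nat) (v : 'rV[R]_N) :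
  is_vertex (perm_hull R N) v -> exists s : 'S_N, v = perm_point R s.
Proof.
move=> /face_is_color[c vE].
have /color_face_compat[s _] : color_face c v by rewrite -vE.
by rewrite -vE /= => <-; exists s.
Qed.

(** * Edges and the weak order *)

Lemma perm_point_swap (R : realType) (N : nat) (s : 'S_N) (i j : 'I_N) :
  perm_point R (tperm i j * s)%g - perm_point R s =
  ((s j)%:R - (s i)%:R) *: (delta_mx ord0 i - delta_mx ord0 j).
Proof.
apply/rowP => k; rewrite !mxE !eqxx permM /=.
have [->|nki] := eqVneq k i.
  rewrite tpermL; have [->|nij] := eqVneq i j; first by rewrite !subrr mulr0.
  by rewrite -[(s j).+1%:R]natr1 -[(s i).+1%:R]natr1 mulr0n mulr1n; ring.
have [->|nkj] := eqVneq k j.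
  by rewrite tpermR -[(s j).+1%:R]natr1 -[(s i).+1%:R]natr1 mulr0n mulr1n; ring.
by rewrite tpermD 1?eq_sym // !subrr mulr0.
Qed.

Lemma weak_functional_swap (R : realType) (N : nat) (s : 'S_N) (i j : 'I_N) :
  weak_functional (perm_point R (tperm i j * s)%g) =
  weak_functional (perm_point R s) + ((s j)%:R - (s i)%:R) * (j%:R - i%:R).
Proof.
have wE k : weak_functional (delta_mx ord0 k : 'rV[R]_N) = - k.+1%:R.
  rewrite /weak_functional (bigD1 k) //= !mxE !eqxx mulr1 big1 ?addr0 // => l nlk.
  by rewrite mxE (negPf nlk) andbF mulr0.
apply/eqP; rewrite addrC -subr_eq -linearB perm_point_swap linearZ linearB /= !wE.
by rewrite -!natr1; apply/eqP; ring.
Qed.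

(** No value lies strictly between two consecutive ones, so the swap affects only the comparison of
    [i] with [j]. *)
Lemma adjacent_swap_lt (N : nat) (s : 'S_N) (i j k l : 'I_N) :
  s j = (s i).+1 :> nat -> ((tperm i j * s)%g k < (tperm i j * s)%g l)%N =
  if (k == i) && (l == j) then false
  else if (k == j) && (l == i) then true else (s k < s l)%N.
Proof.
move=> sij; have nij : i != j by apply/eqP => ij; move: sij; rewrite ij; lia.
have sinj a b : a != b -> s a <> s b :> nat.
  by move=> nab /val_inj/perm_inj ab; rewrite ab eqxx in nab.
have sE m : (tperm i j * s)%g m = s (tperm i j m) by rewrite permM.
rewrite !sE.
case: tpermP => [->|->|/eqP ki /eqP kj]; case: tpermP => [->|->|/eqP li /eqP lj];
  rewrite ?eqxx ?(negPf nij) ?[j == i]eq_sym ?(negPf nij) ?(negPf ki)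
    ?(negPf kj) ?(negPf li) ?(negPf lj) ?andbF ?ltnn //=.
- by lia.
- by have := sinj _ _ li; have := sinj _ _ lj; lia.
- by lia.
- by have := sinj _ _ li; have := sinj _ _ lj; lia.
- by have := sinj _ _ ki; have := sinj _ _ kj; lia.
- by have := sinj _ _ ki; have := sinj _ _ kj; lia.
Qed.

(* The edge is the face whose ordered partition merges the parts {i} and {j}. *)
Lemma adjacent_swap_edge (R : realType) (N : nat) (s : 'S_N) (i j : 'I_N) :
  (i < j)%N -> s j = (s i).+1 :> nat ->
  edge_step (P := permutahedron R N) (perm_point R s)
    (perm_point R (tperm i j * s)%g).
Proof.
move=> ltij sij; have nij : i != j by rewrite -(inj_eq val_inj) ltn_eqF.
have sinj a b : a != b -> s a <> s b :> nat.
  by move=> nab /val_inj/perm_inj ab; rewrite ab eqxx in nab.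
split; [exact: perm_point_vertex|exact: perm_point_vertex| |]; last first.
  rewrite [ltRHS]weak_functional_swap ltrDl mulr_gt0 // subr_gt0 ltr_nat //.
  by rewrite sij.
pose c (k : 'I_N) : R := (if k == j then s i else s k)%:R.
have cs : compat c s.
  apply/compatP => k l; rewrite /c ltr_nat.
  have [->|nkj] := eqVneq k j; have [->|nlj] := eqVneq l j; rewrite ?ltnn //.
    by have := sinj _ _ nlj; lia.
  by have := sinj _ _ nkj; lia.
have cs' : compat c (tperm i j * s)%g.
  apply/compatP => k l; rewrite /c ltr_nat (adjacent_swap_lt _ _ sij).
  have [->|nkj] := eqVneq k j; have [->|nlj] := eqVneq l j;
    rewrite ?ltnn ?andbF ?(negPf nij) //=.
  - have [->//|nli] := eqVneq l i.
    by have := sinj _ _ nlj; lia.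
  - have [->|nki] := eqVneq k i; first by rewrite ltnn.
    by rewrite /=; have := sinj _ _ nkj; lia.
have Fs := (color_face_point c s).2 cs; have Fs' := (color_face_point c _).2 cs'.
exists (color_face c); split=> //; split; first exact: color_is_face.
apply/eqP; rewrite eqn_leq; apply/andP; split.
  pose B : 'rV[R]_N := delta_mx ord0 i - delta_mx ord0 j.
  apply: leq_trans (rank_leq_row B); apply: affdim_le.
  suff sB x : color_face c x -> (x - perm_point R s <= B)%MS.
    move=> x y /sB xB /sB yB.
    rewrite -(subrKA (perm_point R s) x) -[perm_point R s - y]opprB.
    by rewrite addmx_sub ?eqmx_opp.
  apply: color_face_dir => u /compatP cu.
  (* The coloring forces how [k] compares with every other index, and the value at [k] counts these
     comparisons. *)
  have uk k : k != i -> k != j -> u k = s k :> nat.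
    move=> nki nkj; rewrite -(perm_val_count u) -(perm_val_count s).
    apply: eq_bigr => l _; congr nat_of_bool.
    have [->|nlk] := eqVneq l k; first by rewrite !ltnn.
    have clk (a b : 'I_N) :
        ((if a == j then s i else s a) < (if b == j then s i else s b))%N ->
        (u a < u b)%N.
      by move=> ab; apply: cu; rewrite /c ltr_nat.
    have := clk l k; have := clk k l; rewrite (negPf nkj).
    have := sinj _ _ nki; have := sinj _ _ nkj.
    have [->|nlj] := eqVneq l j; first lia.
    by have := sinj _ _ nlk; lia.
  (* All permutations have the same total value, so [u] has one degree of freedom left, along
     [B]. *)
  have uij : (u i + u j = s i + s j)%N.
    have : (\sum_k u k = \sum_k s k)%N.
      by rewrite -!(reindex_inj (@perm_inj _ _) (P := xpredT)
        (F := fun k : 'I_N => k : nat)).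
    rewrite (bigD1 i) // (bigD1 j) 1?eq_sym //=
      [RHS](bigD1 i) // [in RHS](bigD1 j) 1?eq_sym //=.
    rewrite [X in (_ + (_ + X))%N](eq_bigr (fun k => s k : nat)) ?addnA; last first.
      by move=> k /andP[]; apply: uk.
    by move/addIn.
  apply/sub_rVP; exists ((u i)%:R - (s i)%:R).
  have uijR : (u j)%:R - (s j)%:R = - ((u i)%:R - (s i)%:R) :> R.
    by apply/eqP; rewrite opprB subr_eq addrAC eq_sym subr_eq -!natrD -uij addnC.
  apply/rowP => k; rewrite !mxE !eqxx /=.
  have [->|nki] := eqVneq k i; first by rewrite (negPf nij)
    -[(u i).+1%:R]natr1 -[(s i).+1%:R]natr1 mulr0n mulr1n; ring.
  have [->|nkj] := eqVneq k j; first by move: uijR;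
    rewrite -[(u j).+1%:R]natr1 -[(s j).+1%:R]natr1 mulr0n mulr1n; lra.
  by rewrite uk // !subrr mulr0.
pose M : 'M[R]_(1, N) := perm_point R (tperm i j * s)%g - perm_point R s.
have M1 : \rank M = 1%N.
  rewrite rank_rV; apply/eqP; rewrite eqb1 subr_eq0 (inj_eq (@perm_point_inj R N)).
  apply/eqP => /permP/(_ i); rewrite permM tpermL => /perm_inj ji.
  by rewrite ji eqxx in nij.
rewrite -M1; apply: affdim_ge Fs _ => l.
by rewrite ord1 row_id addrC subrK.
Qed.

(** Otherwise [t] increases along consecutive values of [s], hence, by induction on the gap between
    values, along the whole order of [s], and [t = s]. *)
Lemma adjacent_inversion (N : nat) (s t : 'S_N) :
  s != t -> exists i j, s j = (s i).+1 :> nat /\ (t j < t i)%N.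
Proof.
apply: contra_neqP => noinv; apply/esym.
have adj i j : s j = (s i).+1 :> nat -> (t i < t j)%N.
  move=> sij; rewrite perm_neq_lt; first by apply/negP => tji; apply: noinv; exists i, j.
  by apply/eqP => ij; move: sij; rewrite ij; lia.
apply: same_order_eq => i j; move dE : (s j - (s i).+1)%N => d.
elim: d j dE => [|d IH] j dE lts; first by apply: adj; lia.
have kP : (s i + d.+1 < N)%N by have := ltn_ord (s j); lia.
pose k := (s^-1)%g (Ordinal kP).
have sk : s k = (s i + d.+1)%N :> nat by rewrite permKV.
by apply: ltn_trans (IH k _ _) (adj _ _ _); lia.
Qed.

(** As long as [s] differs from [t], some pair with consecutive values in [s] is inverted by [t];
    swapping it climbs one edge. The induction is on the number of inversions of [t] that [s]
    lacks. *)
Lemma weak_order (R : realType) (N : nat) (s t : 'S_N) :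
  (forall i j : 'I_N, (i < j)%N -> (s j < s i)%N -> (t j < t i)%N) ->
  vertex_le (P := permutahedron R N) (perm_point R s) (perm_point R t).
Proof.
pose D (s : 'S_N) :=
  [set p : 'I_N * 'I_N | [&& (p.1 < p.2)%N, (t p.2 < t p.1)%N
    & (s p.1 < s p.2)%N]]%SET.
move dE : #|D s| => d; elim/ltn_ind: d s dE => d IH s dE sub.
have [->|/adjacent_inversion[i [j [sij tji]]]] := eqVneq s t.
  exact: rt_refl.
(* If [j < i], this pair would be an inversion of [s], hence of [t], against [tji]. *)
have ltij : (i < j)%N.
  rewrite ltnNge leq_eqVlt; apply/negP => /orP[/eqP/val_inj ij|ltji].
    by rewrite ij ltnn in tji.
  by have := sub _ _ ltji; rewrite sij ltnSn => /(_ isT); lia.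
apply: rt_trans (rt_step _ _ _ _ (adjacent_swap_edge R ltij sij)) _.
apply: (IH _ _ _ erefl) => [|k l ltkl].
  rewrite -dE; apply/proper_card/properP; split.
    apply/fintype.subsetP => -[k l]; rewrite !inE /= => /and3P[ltkl -> +]; rewrite ltkl.
    rewrite (adjacent_swap_lt _ _ sij) /=; case: ifP => // _.
    by case: ifP => // /andP[/eqP kj /eqP li]; move: ltkl; rewrite kj li; lia.
  exists (i, j); rewrite !inE /= ltij tji /= ?sij ?ltnSn //.
  by rewrite (adjacent_swap_lt _ _ sij) !eqxx.
rewrite (adjacent_swap_lt _ _ sij).
case: ifP => // /negP nlk; case: ifP => [/andP[/eqP -> /eqP ->]//|_].
exact: sub.
Qed.

(** For [i < j], the top of the first face inverts the pair exactly when [c j <= c i]; then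
    [c' j < c' i], so the bottom of the second face inverts it too, and [weak_order] applies. *)
Lemma color_face_le (R : realType) (N : nat) (c c' : 'I_N -> R) :
  (forall i j : 'I_N, (i < j)%N -> c i < c j \/ c' j < c' i) ->
  face_le (P := permutahedron R N) (color_face c) (color_face c').
Proof.
move=> cc'; have [t tE] := color_top c; have [b bE] := color_bottom c'.
exists (perm_point R t), (perm_point R b); split.
- split; first exact: perm_point_vertex.
    by apply/color_face_point/compatP => i j ltc; rewrite tE ltc.
  move=> _ /vertex_perm_point[s ->] /color_face_point/compatP cs.
  apply: weak_order => i j ltij ltsji; rewrite tE ltij andbT.
  by case: (ltgtP (c j) (c i)) => // /cs; lia.
- split; first exact: perm_point_vertex.
    by apply/color_face_point/compatP => i j ltc; rewrite bE ltc.
  move=> _ /vertex_perm_point[s ->] /color_face_point/compatP cs.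
  apply: weak_order => i j ltij; rewrite bE => /orP[/cs//|/andP[_]]; lia.
- apply: weak_order => i j ltij; rewrite tE bE => tji.
  by case: (cc' _ _ ltij) => [cij|-> //]; move: tji; case: ltgtP cij.
Qed.

(** * Dimensions of the faces, and the orientation *)

Lemma compat_swap (R : realType) (N : nat) (c : 'I_N -> R) (s : 'S_N)
    (i j : 'I_N) :
  c i = c j -> compat c s -> compat c (tperm i j * s)%g.
Proof.
move=> cij /compatP cs; have ct k : c (tperm i j k) = c k.
  by case: tpermP => [->|->|_ _]; rewrite ?cij.
by apply/compatP => k l ltc; rewrite !permM; apply: cs; rewrite !ct.
Qed.

Lemma color_functional_delta (R : realType) (N : nat) (c : 'I_N -> R) (i : 'I_N) :
  color_functional c (delta_mx ord0 i) = c i.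
Proof.
rewrite /color_functional (bigD1 i) //= mxE !eqxx mulr1 big1 ?addr0 // => j nji.
by rewrite mxE (negPf nji) andbF mulr0.
Qed.

(* A functional constant on the face takes equal values on any two indices of
   the same color, hence lies in the span of the indicators of the colors. *)
Lemma affdim_color_face_ge (R : realType) (N q : nat) (T : 'I_N -> nat) :
  (forall i, T i < q)%N ->
  (N - q <= affdim (color_face (fun i => (T i)%:R : R)))%N.
Proof.
move=> Tq; set c := fun i => _; have [t tE] := color_top c.
have ct : compat c t by apply/compatP => i j ltc; rewrite tE ltc.
pose rep i := odflt i [pick j | T j == T i].
have Trep i : T (rep i) = T i by rewrite /rep; case: pickP => //= j /eqP.
(* Each row is the displacement obtained by swapping [i] with the chosen representative of its
   color, which stays in the face. *)
pose M : 'M[R]_N :=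
  \matrix_i (perm_point R (tperm i (rep i) * t)%g - perm_point R t).
have rankM : (\rank M <= affdim (color_face c))%N.
  apply: (affdim_ge ((color_face_point c t).2 ct)) => i.
  rewrite rowK addrC subrK; apply/color_face_point/compat_swap => //.
  by rewrite /c Trep.
(* The bound on the rank becomes a bound by [q] on the space of functionals vanishing on the rows of
   [M]. *)
apply: leq_trans rankM; rewrite leq_subCl -mxrank_tr -mxrank_ker.
pose G : 'M[R]_(q, N) := \matrix_(a, i) (T i == a)%:R.
apply: leq_trans (rank_leq_row G); apply/mxrankS/row_subP => l.
move: (row l _) (row_sub l (kermx M^T)) => u /sub_kermxP uM.
have urep i : u ord0 (rep i) = u ord0 i.
  have [->//|nri] := eqVneq (rep i) i.
  have : color_functional (u ord0) (row i M) = 0.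
    have /rowP/(_ i) := uM; rewrite !mxE => <-; apply: eq_bigr => k _.
    by rewrite !mxE.
  rewrite rowK perm_point_swap linearZ linearB /= !color_functional_delta.
  move/eqP; rewrite mulf_eq0 !subr_eq0 eqr_nat (inj_eq val_inj) (inj_eq perm_inj).
  by rewrite (negPf nri) /= eq_sym => /eqP.
(* The coefficient at color [a] is the value of [u] at a representative, and 0 for a color that does
   not occur. *)
apply/submxP; exists (\row_a oapp (u ord0) 0 [pick j | T j == a]).
apply/rowP => i; rewrite [RHS]mxE (bigD1 (Ordinal (Tq i))) //= big1 => [|a naT].
  rewrite -urep !mxE /= eqxx mulr1 addr0 /rep.
  by case: pickP => //= no; have := no i; rewrite eqxx.
move: naT; rewrite !mxE eq_sym -(inj_eq val_inj) /= => naT.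
by rewrite (negPf naT) mulr0.
Qed.

(** Every permutation is compatible with a constant coloring, so the functional is constant; the
    permutahedron is thus itself a color face, with one part. *)
Lemma color_face_cst (R : realType) (N : nat) (a : R) :
  color_face (fun=> a) = perm_hull R N.
Proof.
have ca s : compat (N := N) (fun=> a) s by apply/compatP => i j; rewrite ltxx.
have cst x : perm_hull R N x ->
    color_functional (fun=> a) x = color_bound (fun _ : 'I_N => a).
  move=> [m [b [p [_ b1 Sp ->]]]]; rewrite linear_sum -[RHS]mul1r -b1 mulr_suml.
  apply: eq_bigr => i _; rewrite linearZ /=; congr (_ * _); have [s _ <-] := Sp i.
  by have := ca s; rewrite -(color_functional_leif _ s).2 => /eqP.
by apply/seteqP; split=> [x []//|x hx]; split => // y hy; rewrite !cst.
Qed.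

Lemma sub_kermx_color (R : realType) (N : nat) (c : 'I_N -> R) (x : 'rV[R]_N) :
  (x <= kermx (\col_i c i))%MS = (color_functional c x == 0).
Proof.
have E : x *m (\col_i c i) = (color_functional c x)%:M.
  apply/rowP => k; rewrite ord1 !mxE mulr1n.
  by apply: eq_bigr => i _; rewrite mxE mulrC.
apply/sub_kermxP/eqP => [|c0]; last by rewrite E c0 raddf0.
by rewrite E => /rowP/(_ ord0); rewrite !mxE.
Qed.

Lemma perm_hull_dir (R : realType) (N : nat) (x y : 'rV[R]_N) :
  perm_hull R N x -> perm_hull R N y ->
  (x - y <= kermx (\col_(i < N) (1 : R)))%MS.
Proof.
rewrite -(color_face_cst N 1) sub_kermx_color linearB /=.
by move=> /color_face_max -> /color_face_max ->; rewrite subrr.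
Qed.

Lemma rank_ker_ones (R : realType) (n : nat) :
  \rank (kermx (\col_(i < n.+1) (1 : R))) = n.
Proof.
rewrite mxrank_ker -mxrank_tr rank_rV.
suff -> : (\col_(i < n.+1) (1 : R))^T != 0 by rewrite subn1.
by apply/eqP => /rowP/(_ ord0)/eqP; rewrite !mxE oner_eq0.
Qed.

Lemma dim_permutahedron (R : realType) (n : nat) :
  Defs.dim (permutahedron R n.+1) = n.
Proof.
apply/eqP; rewrite eqn_leq; apply/andP; split.
  by rewrite -[leqRHS](rank_ker_ones R n); apply: affdim_le; exact: perm_hull_dir.
have := @affdim_color_face_ge R n.+1 1 (fun=> 0%N) (fun=> isT).
by rewrite color_face_cst subSS subn0.
Qed.

(** Directions of the face are killed both by the sum of coordinates and by [c]. If the second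
    condition followed from the first, [c] would be constant on the permutahedron and the face would
    be everything. *)
Lemma affdim_proper_face (R : realType) (n : nat) (F : set 'rV[R]_n.+1) :
  is_face (perm_hull R n.+1) F -> F <> perm_hull R n.+1 -> (affdim F < n)%N.
Proof.
move=> faceF ne; have [[y Fy] _] := faceF; have [c FE] := face_is_color faceF.
have [x [hx nFx]] : exists x, perm_hull R n.+1 x /\ ~ F x.
  apply: contrapT => no; apply: ne; apply/seteqP; split=> x; first by rewrite FE => -[].
  by move=> hx; apply: contrapT => nFx; apply: no; exists x.
pose K1 := kermx (\col_(i < n.+1) (1 : R)); pose Kc := kermx (\col_i c i).
have sub x' y' : F x' -> F y' -> (x' - y' <= K1 :&: Kc)%MS.
  rewrite FE => Fx' Fy'; rewrite sub_capmx; apply/andP; split.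
    by apply: perm_hull_dir; [case: Fx' | case: Fy'].
  by rewrite sub_kermx_color linearB /= !color_face_max // subrr.
apply: leq_ltn_trans (affdim_le sub) _; rewrite -[ltnRHS](rank_ker_ones R n).
suff : (K1 :&: Kc < K1)%MS by rewrite ltmxErank => /andP[].
rewrite ltmxE capmxSl /=; apply/negP => K1c; apply: nFx.
move: Fy; rewrite FE => Fy; have [hy ymax] := Fy.
have : (x - y <= K1 :&: Kc)%MS.
  by apply: submx_trans K1c; apply: perm_hull_dir.
rewrite sub_capmx => /andP[_]; rewrite sub_kermx_color linearB subr_eq0 /= => /eqP xy.
by split=> // z /ymax; rewrite -xy.
Qed.

(** An injective coloring cuts out a single vertex, so on an edge two indices share a color;
    swapping their values stays on the edge and changes the functional by a product of two nonzero
    differences. *)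
Lemma permutahedron_oriented (R : realType) (N : nat) :
  is_oriented_polytope (permutahedron R N).
Proof.
split.
  by exists (range (@perm_point R N)) => //; apply/finite_image/finite_finset.
move=> F [faceF dimF]; have [[z Fz] _] := faceF; have [c FE] := face_is_color faceF.
have /injectivePn[i [j nij cij]] : ~~ injectiveb c.
  apply/negP => /injectiveP c_inj; have [t tE] := color_top c.
  move: dimF; rewrite FE (color_face_set1 (s := t)) ?affdim_set1 //.
    by apply/compatP => i j ltc; rewrite tE ltc.
  move=> u /compatP cu; apply: same_order_eq => i j; rewrite tE => /orP[/cu//|].
  by move=> /andP[/eqP/c_inj ->]; rewrite ltnn.
move: Fz; rewrite FE => /color_face_compat[s cs Fs].
exists (perm_point R s), (perm_point R (tperm i j * s)%g); split => //.
  by apply/color_face_point/compat_swap.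
rewrite [X in _ != X]weak_functional_swap eq_sym -subr_eq0 addrAC subrr add0r.
by rewrite mulf_neq0 // subr_eq0 eqr_nat (inj_eq val_inj) ?(inj_eq perm_inj) // eq_sym.
Qed.

(** * Face chains of small excess *)

Lemma exists_min_excess (R : realType) (P : polytope_data R) (k : nat)
    (F0 : 'I_k -> set 'rV[R]_(ambient P)) :
  is_face_chain F0 -> exists e, is_min_excess P k e.
Proof.
(* No face exceeds the dimension of [P], so [B] bounds all excesses from below, and minimizing
   reduces to natural numbers [exc F - B]. *)
move=> chF0; pose B : int := ((Defs.dim P)%:Z - 1) - k%:Z * ((Defs.dim P)%:Z - 1).
have leB F : is_face_chain F -> B <= exc (P := P) (k := k) F.
  move=> [faceF _ _]; rewrite /exc lerD2l lerN2.
  have -> : k%:Z * ((Defs.dim P)%:Z - 1) = \sum_(i < k) ((Defs.dim P)%:Z - 1).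
    by rewrite sumr_const card_ord -mulr_natl natz.
  apply: ler_sum => i _; rewrite lerD2r lez_nat; apply: affdimS.
  by have [_ [c ->]] := faceF i => x [].
pose Q (d : nat) :=
  `[< exists2 F, is_face_chain F & exc (P := P) (k := k) F = B + d%:Z >].
have dE F : is_face_chain F -> exc (P := P) (k := k) F = B + `|exc F - B|%N%:Z.
  by move=> /leB ?; rewrite gez0_abs ?subr_ge0 // addrCA subrr addr0.
have exQ : exists d, Q d.
  by exists `|exc F0 - B|%N; apply/asboolP; exists F0 => //; apply: dE.
case: (ex_minnP exQ) => d /asboolP[F chF FE] dmin; exists (B + d%:Z); split.
  by exists F.
move=> G chG; rewrite (dE _ chG) lerD2l lez_nat; apply: dmin.
by apply/asboolP; exists G => //; apply: dE.
Qed.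

(** The reversed residue is less than [r ^ m], so the sum encodes the pair of quotient and reversed
    residue lexicographically. *)
Definition chain_color (r m i : nat) : nat :=
  (i %/ r ^ m.+1 * r ^ m + (r ^ m - (i %% r ^ m).+1))%N.

Lemma chain_color_bound (r m i : nat) :
  (0 < r)%N -> (chain_color r m i < i %/ r + r ^ m)%N.
Proof.
move=> r0; have rm0 : (0 < r ^ m)%N by rewrite expn_gt0 r0.
have := leq_trunc_div (i %/ r) (r ^ m).
by rewrite /chain_color expnS divnMA; lia.
Qed.

Lemma chain_color_step (r m i j : nat) : (0 < r)%N -> (i < j)%N ->
  (chain_color r m i < chain_color r m j)%N \/
  (chain_color r m.+1 j < chain_color r m.+1 i)%N.
Proof.
move=> r0 ltij; have rm0 : (0 < r ^ m)%N by rewrite expn_gt0 r0.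
have rm1 : (0 < r ^ m.+1)%N by rewrite expn_gt0 r0.
have := leq_div2r (r ^ m.+1) (ltnW ltij); rewrite leq_eqVlt => /orP[/eqP Eq|lt_q].
  right; have Em : forall n, (n %/ r ^ m.+2 = n %/ r ^ m.+1 %/ r)%N.
    by move=> n; rewrite [(r ^ m.+2)%N]expnSr divnMA.
  rewrite /chain_color !Em Eq ltn_add2l.
  have := ltn_pmod j rm1; have := divn_eq i (r ^ m.+1); have := divn_eq j (r ^ m.+1).
  by rewrite Eq; lia.
(* One more unit of quotient adds [r ^ m], which outweighs any difference of reversed residues. *)
left; rewrite /chain_color; set q := (r ^ m)%N in rm0 *.
have le_q : ((i %/ r ^ m.+1).+1 * q <= j %/ r ^ m.+1 * q)%N.
  by rewrite leq_mul2r lt_q orbT.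
by move: le_q; rewrite mulSn; lia.
Qed.

Lemma chain_faces (R : realType) (n k r : nat) : (0 < r)%N -> k != 1%N ->
  is_face_chain (P := permutahedra R n) (fun m : 'I_k =>
    color_face (fun i : 'I_n.+1 => (chain_color r m i)%:R : R)).
Proof.
move=> r0 k1; split=> [i|i j ij|/eqP]; last by rewrite (negPf k1).
- exact: color_is_face.
- apply: color_face_le => a b ltab; rewrite !ltr_nat ij.
  exact: chain_color_step.
Qed.

Lemma facet_chain (R : realType) (n : nat) : (0 < n)%N ->
  is_face_chain (P := permutahedra R n) (fun _ : 'I_1 =>
    color_face (fun i : 'I_n.+1 => (i != ord0)%:R : R)).
Proof.
move=> n0; split=> [i|i j|_ _ E]; first exact: color_is_face.
  by rewrite !ord1.
(* The swap of the first two indices does not give the first one the least value, so its point lies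
   outside the facet. *)
pose o : 'I_n.+1 := Ordinal (n0 : (1 < n.+1)%N).
have : perm_hull R n.+1 (perm_point R (tperm ord0 o)) by apply: perm_hull_point.
rewrite -[perm_hull _ _]E => /color_face_point/compatP/(_ ord0 o).
by rewrite tpermL tpermR eqxx ltr01 => /(_ isT).
Qed.

(** * The minimum excess and its asymptotics *)

Lemma min_excess_exists (R : realType) (k n : nat) : (0 < k)%N -> (0 < n)%N ->
  exists e, is_min_excess (permutahedra R n) k e.
Proof.
case: k => [//|[|k]] _ n0.
  exact: exists_min_excess (facet_chain R n0).
by apply: exists_min_excess (@chain_faces R n k.+2 1 _ _).
Qed.

(** A proper face has dimension at most [n - 1], and the two-part coloring of [facet_chain] reaches
    it. *)
Lemma min_excess1 (R : realType) (n : nat) (e : int) : (0 < n)%N ->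
  is_min_excess (permutahedra R n) 1 e -> e = 1.
Proof.
move=> n0 [[F [faceF _ ne] <-] minF]; apply/eqP; rewrite eq_le; apply/andP; split.
  apply: le_trans (minF _ (facet_chain R n0)) _.
  rewrite /exc big_ord1 dim_permutahedron.
  apply: (@le_trans _ _ ((n%:Z - 1) - ((n.+1 - 2)%N%:Z - 1))); last lia.
  rewrite lerD2l lerN2 lerD2r lez_nat; apply: affdim_color_face_ge => i.
  exact: leq_b1.
rewrite /exc big_ord1 dim_permutahedron.
apply: (@le_trans _ _ ((n%:Z - 1) - (n.-1%:Z - 1))); first lia.
rewrite lerD2l lerN2 lerD2r lez_nat -ltnS prednK //.
exact: affdim_proper_face (faceF ord0) (ne erefl ord0).
Qed.

Lemma min_excess_bounds (R : realType) (k n r : nat) (e : int) :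
  (1 < k)%N -> (0 < r)%N -> is_min_excess (permutahedra R n) k e ->
  `|e - E k n| <= k%:Z * (n %/ r + r ^ k)%:Z.
Proof.
move=> k1 r0 [[F [faceF _ _] FE] minF].
have rk0 : (0 < r ^ k)%N by rewrite expn_gt0 r0.
rewrite ler_norml; apply/andP; split.
  rewrite -FE /exc dim_permutahedron.
  have : \sum_(i < k) ((affdim (F i))%:Z - 1) <= \sum_(i < k) (n%:Z - 1).
    apply: ler_sum => i _; rewrite lerD2r lez_nat -[leqRHS](dim_permutahedron R).
    by apply: affdimS; have [_ [c ->]] := faceF i => x [].
  rewrite sumr_const card_ord -mulr_natl natz /E.
  (* The dimension bound gives [e >= E k n - k]; a positive [n %/ r + r ^ k] absorbs this [k]. *)
  have : (0 < n %/ r + r ^ k)%N by rewrite addn_gt0 rk0 orbT.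
  by move: (n %/ r + r ^ k)%N (\sum_(i < k) _) => q S; nia.
have := minF _ (@chain_faces R n k r r0 _); rewrite neq_ltn k1 orbT => /(_ isT).
set q := (n %/ r + r ^ k)%N => /le_trans le_e.
have {le_e} : e <= (n%:Z - 1) - \sum_(i < k) (n%:Z - q%:Z).
  apply: le_e; rewrite /exc dim_permutahedron lerD2l lerN2.
  apply: ler_sum => i _.
  apply: (@le_trans _ _ ((n.+1 - q)%N%:Z - 1)); first by lia.
  rewrite lerD2r lez_nat; apply: affdim_color_face_ge => j.
  apply: leq_trans (chain_color_bound _ _ r0) _.
  apply: leq_add; first by apply: leq_div2r; rewrite -ltnS.
  by apply: leq_pexp2l => //; apply: ltnW.
by rewrite sumr_const card_ord -mulr_natl natz /E; move: q => q; nia.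
Qed.

Lemma min_excess_ratio (R : realType) (k : nat) (e : nat -> int) : (0 < k)%N ->
  (forall n, (0 < n)%N -> is_min_excess (permutahedra R n) k (e n)) ->
  ((fun n => (e n)%:~R / (E k n)%:~R : R) @ \oo --> (1 : R))%classic.
Proof.
case: k => [//|[|k]] _ eP.
  apply: cvg_near_cst; exists 1%N => // n /= n0; rewrite (min_excess1 n0 (eP n n0)).
  suff -> : E 1 n = 1 by rewrite divr1.
  by rewrite /E; lia.
apply/cvgrPdist_le => eps eps0.
(* The base makes [n %/ r] at most [eps * n / 8]; the threshold [n0] then does the same for
   [r ^ k.+2]. *)
pose r := (Num.bound (8 / eps)).+1.
have r_eps : 8 <= r%:R * eps.
  rewrite -ler_pdivrMr //; apply: ltW; apply: lt_trans (archi_boundP _) _.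
    by rewrite divr_ge0 // ltW.
  by rewrite ltr_nat.
pose n0 := Num.bound (8 * (r ^ k.+2)%:R / eps).
exists (n0 + 8)%N => // n /= le_n.
have n_eps : 8 * (r ^ k.+2)%:R <= n%:R * eps.
  rewrite -ler_pdivrMr //; apply: ltW; apply: lt_le_trans (archi_boundP _) _.
    by rewrite divr_ge0 ?mulr_ge0 // ltW.
  by rewrite ler_nat; apply: leq_trans le_n; apply: leq_addr.
have n1 : (0 < n)%N by lia.
have bd := @min_excess_bounds R k.+2 n r (e n) isT isT (eP n n1).
(* Here [n >= 8] matters: it keeps the constant terms of [E] from cancelling more than the factor 4
   allows. *)
have E_lt : k.+2%:Z * n%:Z <= 4 * `|E k.+2 n|.
  by rewrite -normrN; apply: le_trans (ler_wpM2l _ (ler_norm _)) => //; rewrite /E; nia.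
have En0 : E k.+2 n != 0 by rewrite /E; nia.
have EnR : (E k.+2 n)%:~R != 0 :> R by rewrite intr_eq0.
have -> : 1 - (e n)%:~R / (E k.+2 n)%:~R =
    - ((e n - E k.+2 n)%:~R / (E k.+2 n)%:~R) :> R.
  by rewrite intrB; field.
rewrite normrN normf_div ler_pdivrMr ?normr_gt0 // -!intr_norm.
apply: (@le_trans _ _ (k.+2%:R * (n %/ r + r ^ k.+2)%:R)).
  by rewrite -natrM pmulrn ler_int PoszM.
have E_ltR : k.+2%:R * n%:R <= 4 * `|E k.+2 n|%:~R :> R.
  have E4 : (4 : int)%:~R = 4 :> R by rewrite rmorph_nat.
  rewrite -natrM -[X in _ <= X * _]E4 -intrM pmulrn ler_int.
  by rewrite PoszM.
have div_le : (n %/ r)%:R * r%:R <= n%:R :> R by rewrite -natrM ler_nat leq_trunc_div.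
have q_le : 4 * (n %/ r + r ^ k.+2)%:R <= eps * n%:R :> R.
  have : 8 * (n %/ r)%:R <= n%:R * eps :> R.
    apply: (@le_trans _ _ ((n %/ r)%:R * (r%:R * eps))).
      by rewrite mulrC ler_wpM2l.
    by rewrite mulrA ler_wpM2r // ltW.
  by rewrite natrD; lra.
rewrite -(ler_pM2l (ltr0n R 4 : 0 < 4)) //.
apply: (@le_trans _ _ (k.+2%:R * (eps * n%:R))).
  by rewrite mulrCA ler_wpM2l.
by rewrite mulrCA [leRHS]mulrCA ler_wpM2l // ltW.
Qed.

Lemma permutahedra_k_length (R : realType) (k : nat) : (0 < k)%N ->
  has_asymptotic_k_length (permutahedra R) k 1.
Proof.
move=> k0; have /choice[e eP] n :
    exists e, (0 < n)%N -> is_min_excess (permutahedra R n) k e.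
  have [n0|_] := boolP (0 < n)%N; last by exists 0.
  by have [e eP] := min_excess_exists R k0 n0; exists e.
by exists e => //; apply: min_excess_ratio.
Qed.

Theorem theorem2p1 (R : realType) :
  is_polytope_family (permutahedra R) /\
  (forall k : nat, (1 <= k)%N ->
     has_asymptotic_k_length (permutahedra R) k 1) /\
  has_asymptotic_total_length (permutahedra R) 1.
Proof.
split.
  by move=> n _; split; [exact: permutahedron_oriented | exact: dim_permutahedron].
split; first exact: permutahedra_k_length.
by exists (fun=> 1); [exact: permutahedra_k_length | exact: cvg_cst].
Qed.
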